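(* Let $\mathbb F$ be a field, let $\mathfrak q=(q_{ij})$ be a multiplicatively antisymmetric $n\times n$ matrix over $\mathbb F^\ast$, and let $\mathcal O_{\mathfrak q}(\mathbb F^n)$ be the corresponding quantum affine space. Suppose that the subgroup $\Lambda=\langle q_{ij}\rangle$ of $\mathbb F^\ast$ has (torsion-free) rank no smaller than $\binom{n-1}{2}+1$. Then $$\mathrm{Aut}(\mathcal O_{\mathfrak q}(\mathbb F^n))=(\mathbb F^\ast)^n,$$ that is, every $\mathbb F$-algebra automorphism of $\mathcal O_{\mathfrak q}(\mathbb F^n)$ is of the form $X_i\mapsto a_iX_i$ $(1\le i\le n)$ for some $(a_1,\dots,a_n)\in(\mathbb F^\ast)^n$.
   Context: Multiplicatively antisymmetric means $q_{ii}=1$ and $q_{ji}=q_{ij}^{-1}$ for all $i,j$. The quantum affine space is $\mathcal O_{\mathfrak q}(\mathbb F^n)=\mathbb F\langle X_1,\dots,X_n\rangle/(X_iX_j-q_{ij}X_jX_i)$. The torus $(\mathbb F^\ast)^n$ acts on it by automorphisms $X_i\mapsto a_iX_i$ and is identified with the resulting group of automorphisms. Automorphisms are $\mathbb F$-algebra automorphisms. The rank of the finitely generated abelian group $\Lambda$ is its torsion-free rank. *)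

(* Defs.v *)
From HB Require Import structures.
From mathcomp Require Import all_boot all_order all_algebra.
From mathcomp Require Import boolp.
From mathcomp Require Import monalg.

Set Implicit Arguments.
Unset Strict Implicit.
Unset Printing Implicit Defensive.

Import GRing.Theory.
Local Open Scope ring_scope.
Local Open Scope quotient_scope.

(* The free algebra is the monoid algebra of the free monoid. *)
Notation free_algebra F n := {malg F[{fmonom 'I_n}]}.

Definition free_var (F : fieldType) (n : nat) (i : 'I_n) : free_algebra F n :=
  << fmu i >>.

Inductive two_sided_ideal (R : nzRingType) (S : R -> Prop) : R -> Prop :=
| ideal_gen x : S x -> two_sided_ideal S x
| ideal_zero : two_sided_ideal S 0
| ideal_sub x y :
    two_sided_ideal S x -> two_sided_ideal S y -> two_sided_ideal S (x - y)
| ideal_mull a x : two_sided_ideal S x -> two_sided_ideal S (a * x)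
| ideal_mulr a x : two_sided_ideal S x -> two_sided_ideal S (x * a).

Definition qrelator (F : fieldType) (n : nat) (q : 'M[F]_n)
    (x : free_algebra F n) : Prop :=
  exists i j : 'I_n, x = free_var F i * free_var F j
                         - q i j *: (free_var F j * free_var F i).

Definition qideal (F : fieldType) (n : nat) (q : 'M[F]_n) :
    {pred free_algebra F n} :=
  fun x => `[< two_sided_ideal (qrelator q) x >].

Section QuantumAffineSpace.
Variables (F : fieldType) (n : nat) (q : 'M[F]_n).
Local Notation A := (free_algebra F n).

Lemma qidealP (x : A) : reflect (two_sided_ideal (qrelator q) x) (x \in qideal q).
Proof. exact: asboolP. Qed.

Lemma qideal_zmod_closed : zmod_closed (qideal q).
Proof.
split; first by apply/qidealP; exact: ideal_zero.
by move=> x y /qidealP hx /qidealP hy; apply/qidealP; exact: ideal_sub.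
Qed.

HB.instance Definition _ := GRing.isZmodClosed.Build A (qideal q) qideal_zmod_closed.

Lemma qideal_mull (a x : A) : x \in qideal q -> a * x \in qideal q.
Proof. by move=> /qidealP hx; apply/qidealP; exact: ideal_mull. Qed.

Lemma qideal_mulr (a x : A) : x \in qideal q -> x * a \in qideal q.
Proof. by move=> /qidealP hx; apply/qidealP; exact: ideal_mulr. Qed.

Lemma free_scaleE (c : F) (x : A) : c *: x = c%:A * x.
Proof. by rewrite -scalerAl mul1r. Qed.

Lemma free_scaler_comm (c : F) (x : A) : c%:A * x = x * c%:A.
Proof.
have E : c%:A = (c%:MP : A).
  by rewrite -[RHS]mulr1 mul_malgC.
rewrite E [x]monalgE mulr_suml mulr_sumr; apply: eq_bigr => k _.
rewrite !malgM_def /= fgmulUU fgmulUU.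
by rewrite mul1m mulm1 mulrC.
Qed.

Lemma free_scalerAr (c : F) (x y : A) : c *: (x * y) = x * (c *: y).
Proof.
by rewrite (free_scaleE c (x * y)) (free_scaleE c y) !mulrA free_scaler_comm.
Qed.

Lemma qideal_scale (c : F) (x : A) : x \in qideal q -> c *: x \in qideal q.
Proof. by rewrite free_scaleE; exact: qideal_mull. Qed.

(* The constant coefficient vanishes on the ideal, so that it is proper. *)
Lemma qideal_const (x : A) : x \in qideal q -> x@_mone = 0.
Proof.
have mcM (u v : A) : (u * v)@_mone = u@_mone * v@_mone.
  by have [h _] := @mcoeff1g_is_multiplicative {fmonom 'I_n} F; exact: h.
move=> /qidealP; elim=> [y|||a y _ IH|a y _ IH].
- move=> [i [j ->]].
  have v0 k : (free_var F k : A)@_mone = 0 :> F.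
    rewrite mcoeffU1; case: eqP => // h.
    by have := congr1 (fun m : {fmonom 'I_n} => size m) h;
      rewrite fmuE -[mone]/(fmone _) fmoneE.
  by rewrite mcoeffB mcoeffZ !mcM !v0 !mul0r mulr0 subr0.
- by rewrite mcoeff0.
- by move=> y z _ hy _ hz; rewrite mcoeffB hy hz subr0.
- by rewrite mcM IH mulr0.
- by rewrite mcM IH mul0r.
Qed.

Definition qaffine_space := {ideal_quot qideal q}.
HB.instance Definition _ := GRing.Zmodule.on qaffine_space.
HB.instance Definition _ := ZmodQuotient.on qaffine_space.

Definition qspace_one : qaffine_space := lift_cst qaffine_space 1.
Definition qspace_mul := lift_op2 qaffine_space *%R.
Definition qspace_scale (c : F) := lift_op1 qaffine_space ( *:%R c).

Canonical pi_qspace_one := PiConst qspace_one.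

Lemma qspace_piE (x y : A) :
  (x == y %[mod qaffine_space]) = (x - y \in qideal q).
Proof. by rewrite piE. Qed.

Lemma qspace_reprP (x : A) : x - repr (\pi_qaffine_space x) \in qideal q.
Proof. by rewrite -qspace_piE reprK. Qed.

Lemma pi_qspace_mul : {morph \pi_qaffine_space : x y / x * y >-> qspace_mul x y}.
Proof.
move=> x y; unlock qspace_mul; apply/eqP; rewrite qspace_piE.
set x' := repr _; set y' := repr _.
have -> : x * y - x' * y' = x * (y - y') + (x - x') * y'.
  by rewrite mulrBr mulrBl addrA subrK.
apply: rpredD; first by apply: qideal_mull; exact: qspace_reprP.
by apply: qideal_mulr; exact: qspace_reprP.
Qed.
Canonical pi_qspace_mul_morph := PiMorph2 pi_qspace_mul.

Lemma pi_qspace_scale (c : F) :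
  {morph \pi_qaffine_space : x / c *: x >-> qspace_scale c x}.
Proof.
move=> x; unlock qspace_scale; apply/eqP; rewrite qspace_piE.
by rewrite -scalerBr; apply: qideal_scale; exact: qspace_reprP.
Qed.
Canonical pi_qspace_scale_morph (c : F) := PiMorph1 (pi_qspace_scale c).

Lemma qspace_mulA : associative qspace_mul.
Proof.
by move=> x y z; rewrite -[x]reprK -[y]reprK -[z]reprK !piE mulrA.
Qed.

Lemma qspace_mul1l : left_id qspace_one qspace_mul.
Proof. by move=> x; rewrite -[x]reprK !piE mul1r. Qed.

Lemma qspace_mul1r : right_id qspace_one qspace_mul.
Proof. by move=> x; rewrite -[x]reprK !piE mulr1. Qed.

Lemma qspace_mulDl : left_distributive qspace_mul +%R.
Proof.
by move=> x y z; rewrite -[x]reprK -[y]reprK -[z]reprK !piE mulrDl.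
Qed.

Lemma qspace_mulDr : right_distributive qspace_mul +%R.
Proof.
by move=> x y z; rewrite -[x]reprK -[y]reprK -[z]reprK !piE mulrDr.
Qed.

Lemma qspace_1neq0 : qspace_one != 0.
Proof.
apply/negP; rewrite !piE /= /Quotient.equiv subr0 => /qideal_const.
rewrite mcoeff1 eqxx => /eqP.
by rewrite oner_eq0.
Qed.

HB.instance Definition _ := GRing.Zmodule_isNzRing.Build qaffine_space
  qspace_mulA qspace_mul1l qspace_mul1r qspace_mulDl qspace_mulDr qspace_1neq0.
HB.instance Definition _ :=
  isNzRingQuotient.Build A (Quotient.equiv (qideal q)) 0 -%R +%R 1 *%R
    qaffine_space (lock _) pi_qspace_mul.

Lemma qspace_scaleA (a b : F) x :
  qspace_scale a (qspace_scale b x) = qspace_scale (a * b) x.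
Proof. by rewrite -[x]reprK !piE scalerA. Qed.

Lemma qspace_scale1 : left_id 1 qspace_scale.
Proof. by move=> x; rewrite -[x]reprK !piE scale1r. Qed.

Lemma qspace_scaleDr : right_distributive qspace_scale +%R.
Proof. by move=> c x y; rewrite -[x]reprK -[y]reprK !piE scalerDr. Qed.

Lemma qspace_scaleDl x :
  {morph qspace_scale^~ x : a b / a + b}.
Proof. by move=> a b; rewrite -[x]reprK !piE scalerDl. Qed.

HB.instance Definition _ := GRing.Zmodule_isLmodule.Build F qaffine_space
  qspace_scaleA qspace_scale1 qspace_scaleDr qspace_scaleDl.

Lemma qspace_piZ (c : F) (x : A) :
  \pi_qaffine_space (c *: x) = c *: \pi_qaffine_space x.
Proof. exact: pi_qspace_scale. Qed.

Lemma qspace_scalerAl (c : F) (x y : qaffine_space) :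
  c *: (x * y) = (c *: x) * y.
Proof.
rewrite -[x]reprK -[y]reprK -!(rmorphM \pi_qaffine_space) -!qspace_piZ.
by rewrite -rmorphM scalerAl.
Qed.

HB.instance Definition _ :=
  GRing.Lmodule_isLalgebra.Build F qaffine_space qspace_scalerAl.

Lemma qspace_scalerAr (c : F) (x y : qaffine_space) :
  c *: (x * y) = x * (c *: y).
Proof.
rewrite -[x]reprK -[y]reprK -!(rmorphM \pi_qaffine_space) -!qspace_piZ.
by rewrite -rmorphM free_scalerAr.
Qed.

HB.instance Definition _ :=
  GRing.Lalgebra_isAlgebra.Build F qaffine_space qspace_scalerAr.

Definition qvar (i : 'I_n) : qaffine_space := \pi_qaffine_space (free_var F i).

Lemma qvarM i j : qvar i * qvar j = q i j *: (qvar j * qvar i).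
Proof.
rewrite /qvar -!(rmorphM \pi_qaffine_space) -qspace_piZ.
apply/eqP; rewrite qspace_piE; apply/qidealP.
by apply: ideal_gen; exists i, j.
Qed.

End QuantumAffineSpace.

(* A subgroup of the multiplicative group of F only when all q i j are nonzero. *)
Inductive entry_group (F : fieldType) (n : nat) (q : 'M[F]_n) : F -> Prop :=
| entry_gen i j : entry_group q (q i j)
| entry_one : entry_group q 1
| entry_div x y : entry_group q x -> entry_group q y -> entry_group q (x / y).

(* Z-linear independence, written multiplicatively; only meaningful for nonzero
   u i, since 0 ^ e = 0 for every integer e != 0. *)
Definition mult_independent (F : fieldType) (r : nat) (u : 'I_r -> F) : Prop :=
  forall e : 'I_r -> int, \prod_(i < r) u i ^ e i = 1 -> forall i, e i = 0.

(* r is the maximal size of a Z-linearly independent family in G. *)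
Definition torsion_free_rank (F : fieldType) (G : F -> Prop) (r : nat) : Prop :=
  (exists u : 'I_r -> F, (forall i, G (u i)) /\ mult_independent u) /\
  (forall (s : nat) (u : 'I_s -> F),
     (forall i, G (u i)) -> mult_independent u -> (s <= r)%N).

(* The first clause does not follow from the others off the diagonal, since
   0^-1 = 0. *)
Definition mult_antisymmetric (F : fieldType) (n : nat) (q : 'M[F]_n) : Prop :=
  [/\ forall i j, q i j != 0, forall i, q i i = 1
    & forall i j, q j i = (q i j)^-1].

(* Main.v *)
Require Import Defs.
From HB Require Import structures.
From mathcomp Require Import all_boot all_order all_algebra.
From mathcomp Require Import finmap monalg ring.

(** The monomials [X^u = X_1^u_1 ... X_n^u_n] form a basis of the quantum affine
    space, and [X^u X^v] is a nonzero scalar times [X^(u+v)].  For any total order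
    on exponents invariant under translation, the leading exponent of a product is
    therefore the sum of the leading exponents, and the leading coefficients see the
    commutation bicharacter [commutation q u v = \prod_(i,j) q_ij^(u_i v_j)], which
    is characterized by [X^u X^v = commutation q u v * X^v X^u].

    Let [phi] be an automorphism and [m_i] the leading exponent of [phi(X_i)].
    Applying [phi] to [X_i X_j = q_ij X_j X_i] gives [commutation q m_i m_j = q_ij].
    Three observations finish the proof.

    1. The map [M : u |-> \sum_i u_i m_i] is injective ([image_exp_inj]).  If
       [M u = M v], then [commutation q] cannot tell [u] from [v], so the integer
       vector [u - v] commutes with every unit vector.  The rank hypothesis excludes
       nonzero vectors of this kind ([commuting_exponent0]).

    2. As [M] is injective, no cancellation of leading terms takes place in
       [phi(\sum_u c_u X^u)], whose leading exponent is some [M u].  By surjectivity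
       each unit vector [e_k] is an [M u], hence some [m_i] ([unit_exp_is_leading]).
       This yields a map [s] with [m_(s k) = e_k] and [q_(s k)(s l) = q_kl], and the
       rank hypothesis forces [s = id] ([q_preserving_id]).  So the leading exponent of
       [phi(X_k)] is [e_k], for every order.

    3. Using the lexicographic order and its reverse, the largest and the smallest
       exponent of [phi(X_k)] are both [e_k].  Hence [phi(X_k) = a_k X_k].

    Both uses of the rank rest on one bound ([row_not_span]): the [q_kl] with [k < l]
    and [k, l <> a] are only ['C(n-1, 2)] many, so some [q_aj] has no nonzero power in
    the group that they generate.

    Conversely, the diagonal automorphisms are induced from the free algebra, whose
    relators they rescale ([torus_bij], [torus_qvar]). *)

Set Implicit Arguments.
Unset Strict Implicit.
Unset Printing Implicit Defensive.

Import GRing.Theory Num.Theory.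
Local Open Scope ring_scope.
Local Open Scope quotient_scope.

(** * Multiplicative rank *)

Section PowerSpan.
Variables (F : fieldType) (I : finType) (g : I -> F).
Hypothesis g_neq0 : forall p, g p != 0.

(** The saturation in the unit group of [F] of the subgroup generated by the [g p];
    working up to powers makes [power_span_root] available and does not change the
    rank. *)
Definition power_span (x : F) : Prop :=
  x != 0 /\ exists2 k : int, k != 0
    & exists e : I -> int, x ^ k = \prod_p g p ^ e p.

Lemma prodfz (J : finType) (f : J -> F) (k : int) :
  (forall j, f j != 0) -> (\prod_j f j) ^ k = \prod_j f j ^ k.
Proof.
move=> f0; suff [] : \prod_j f j != 0 /\ (\prod_j f j) ^ k = \prod_j f j ^ k by [].
apply: (big_ind2 (fun x y => x != 0 /\ x ^ k = y)) => [|x1 y1 x2 y2 [? <-] [? <-]|j _].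
- by rewrite oner_neq0 exp1rz.
- by rewrite mulf_neq0 // expfzMl.
- by [].
Qed.

Lemma power_span_gen p : power_span (g p).
Proof.
split=> //; exists 1 => //; exists (fun j => (j == p)%:Z).
rewrite expr1z (bigD1 p) //= eqxx expr1z big1 ?mulr1 // => j /negPf ->.
by rewrite expr0z.
Qed.

Lemma power_span1 : power_span 1.
Proof.
split; first exact: oner_neq0.
by exists 1 => //; exists (fun=> 0); rewrite expr1z big1.
Qed.

Lemma power_spanV x : power_span x -> power_span x^-1.
Proof.
case=> x0 [k k0 [e xk]]; split; first by rewrite invr_eq0.
exists k => //; exists (fun j => - e j).
rewrite exprz_inv -invr_expz xk -prodfV.
by apply: eq_bigr => j _; rewrite invr_expz.
Qed.

Lemma power_spanM x y : power_span x -> power_span y -> power_span (x * y).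
Proof.
case=> x0 [k k0 [e xk]] [y0 [l l0 [f yl]]]; split; first by rewrite mulf_neq0.
exists (k * l); first by rewrite mulf_neq0.
exists (fun j => e j * l + f j * k); rewrite expfzMl.
rewrite -exprz_exp xk (mulrC k) -exprz_exp yl !prodfz -?big_split /=;
  try by move=> j; rewrite expfz_eq0 negb_and g_neq0 orbT.
by apply: eq_bigr => j _; rewrite !exprz_exp expfzDr.
Qed.

Lemma power_span_exp x k : power_span x -> power_span (x ^ k).
Proof.
case=> x0 [l l0 [e xl]]; split; first by rewrite expfz_eq0 negb_and x0 orbT.
exists l => //; exists (fun j => e j * k).
rewrite exprz_exp mulrC -exprz_exp xl prodfz.
  by apply: eq_bigr => j _; rewrite exprz_exp.
by move=> j; rewrite expfz_eq0 negb_and g_neq0 orbT.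
Qed.

Lemma power_span_root x k : x != 0 -> k != 0 -> power_span (x ^ k) -> power_span x.
Proof.
move=> x0 k0 [_ [l l0 [e xl]]]; split=> //; exists (k * l); first by rewrite mulf_neq0.
by exists e; rewrite -exprz_exp.
Qed.

(** More rows than columns force a rational relation between the rows; clearing its
    denominators makes it integral. *)
Lemma int_left_kernel (r d : nat) (E : 'M[int]_(r, d)) : (d < r)%N ->
  exists2 y : 'I_r -> int, (exists i, y i != 0)
    & forall j, \sum_i y i * E i j = 0.
Proof.
move=> ltdr; pose EQ : 'M[rat]_(r, d) := map_mx intr E.
have /rowV0Pn [x xker x0] : kermx EQ != 0.
  by rewrite kermx_eq0 /row_free neq_ltn (leq_ltn_trans (rank_leq_col EQ)).
have [p [a a0 def_p]] := rat_poly_scale (rVpoly x).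
have xE i : x 0 i = a%:~R^-1 * (p`_i)%:~R.
  by rewrite -(coef_rVpoly_ord x) def_p coefZ coef_map.
exists (fun i => p`_i).
  have /rV0Pn [i xi0] := x0; exists i; apply: contraNneq xi0 => pi0.
  by rewrite xE pi0 mulr0.
move=> j; have /matrixP/(_ 0 j) := sub_kermxP xker.
rewrite !mxE => s0; apply/eqP; rewrite -(intr_eq0 rat); apply/eqP.
have a0' : (a%:~R : rat) != 0 by rewrite intr_eq0.
rewrite rmorph_sum /= -[LHS](mulKf (_ : a%:~R^-1 != 0)) ?invr_eq0 //.
rewrite mulr_sumr invrK; rewrite -[RHS](mulr0 a%:~R) -[in RHS]s0; congr (_ * _).
by apply: eq_bigr => i _; rewrite xE mxE rmorphM mulrA.
Qed.

(** Some powers of the [u i] are monomials in the [g p].  With more [u i] than [g p],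
    their exponent vectors satisfy an integral linear relation, which reads as a
    multiplicative relation between the [u i]. *)
Lemma power_span_rank (r : nat) (u : 'I_r -> F) :
  (forall i, power_span (u i)) -> mult_independent u -> (r <= #|I|)%N.
Proof.
move=> hu indep; rewrite leqNgt; apply/negP => ltIr.
have u0 i : u i != 0 by case: (hu i).
have /fin_all_exists2 [k k0 /fin_all_exists [e ue]] :
  forall i, exists2 k : int, k != 0
    & exists e : I -> int, u i ^ k = \prod_p g p ^ e p by move=> i; case: (hu i).
have [y [i0 yi0] yE] := int_left_kernel (\matrix_(i, j) e i (enum_val j)) ltIr.
have/indep/(_ i0)/eqP : \prod_i u i ^ (k i * y i) = 1.
  have -> : \prod_i u i ^ (k i * y i) = \prod_p \prod_i g p ^ (e i p * y i).
    rewrite exchange_big; apply: eq_bigr => i _.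
    rewrite -exprz_exp ue prodfz; last first.
      by move=> j; rewrite expfz_eq0 negb_and g_neq0 orbT.
    by apply: eq_bigr => p _; rewrite exprz_exp.
  rewrite big1 // => p _.
  have -> : \prod_i g p ^ (e i p * y i) = g p ^ (\sum_i e i p * y i).
    by apply/esym/(big_morph (fun z => g p ^ z)) => // a b; rewrite expfzDr.
  have := yE (enum_rank p); under eq_bigr do rewrite mxE enum_rankK mulrC.
  by move=> ->.
by rewrite mulf_eq0 (negPf (k0 i0)) (negPf yi0).
Qed.
End PowerSpan.

Lemma card_ltn_pairs m :
  #|{: {p : 'I_m * 'I_m | (p.1 < p.2)%N}}| = 'C(m, 2).
Proof.
rewrite card_sig -sum1_card.
rewrite -(pair_big_dep xpredT (fun i j : 'I_m => (i < j)%N) (fun _ _ => 1%N)) /=.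
rewrite (exchange_big_dep xpredT) //= -triangular_sum big_mkord.
apply: eq_bigr => j _; rewrite (big_ord_narrow (ltnW (ltn_ord j))).
by rewrite sum1_card card_ord.
Qed.

Section RankBound.
Variables (F : fieldType) (n : nat) (q : 'M[F]_n) (r : nat).
Hypothesis q_antisym : mult_antisymmetric q.
Hypothesis rank_Lambda : torsion_free_rank (entry_group q) r.
Hypothesis r_ge : ('C(n.-1, 2) + 1 <= r)%N.

Let q0 i j : q i j != 0. Proof. by case: q_antisym. Qed.
Let qii i : q i i = 1. Proof. by case: q_antisym. Qed.
Let qV i j : q j i = (q i j)^-1. Proof. by case: q_antisym. Qed.

(** A system of generators, up to inverses and [1], of the group of entries of [q]
    off row and column [a]. *)
Definition minor_gen (a : 'I_n) (p : {p : 'I_n.-1 * 'I_n.-1 | (p.1 < p.2)%N}) : F :=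
  q (lift a (val p).1) (lift a (val p).2).

Let minor_gen_neq0 a p : minor_gen a p != 0. Proof. exact: q0. Qed.

Lemma minor_span a k l : k != a -> l != a -> power_span (minor_gen a) (q k l).
Proof.
rewrite eq_sym => /unlift_some [k' -> _]; rewrite eq_sym => /unlift_some [l' -> _].
have [lkl|lkl|/val_inj ->] := ltngtP k' l'.
- exact: (power_span_gen (minor_gen_neq0 a) (exist _ (k', l') lkl)).
- rewrite qV; apply: power_spanV.
  exact: (power_span_gen (minor_gen_neq0 a) (exist _ (l', k') lkl)).
- by rewrite qii; apply: power_span1.
Qed.

(** Otherwise the whole entry group would lie in the saturation of a group with
    ['C(n.-1, 2)] generators, which is below its rank. *)
Lemma row_not_span a : ~ forall j, j != a -> power_span (minor_gen a) (q a j).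
Proof.
move=> rowP.
have entryP x : entry_group q x -> power_span (minor_gen a) x.
  elim=> [i j||y z _ hy _ hz]; last 2 first.
  - exact: power_span1.
  - by apply: power_spanM => //; apply: power_spanV.
  have [->|ia] := eqVneq i a.
    by have [->|/rowP//] := eqVneq j a; rewrite qii; apply: power_span1.
  have [->|ja] := eqVneq j a; last exact: minor_span.
  by rewrite qV; apply/power_spanV/rowP.
have [[u [uG u_indep]] _] := rank_Lambda.
have := power_span_rank (minor_gen_neq0 a) (fun i => entryP _ (uG i)) u_indep.
by rewrite card_ltn_pairs leqNgt -addn1 r_ge.
Qed.

(** The quantum torus has trivial center.  If [x a != 0], the [j]-th equation
    expresses the power [q a j ^ x a] through the entries [q i j] with [i != a], for
    every [j]; this contradicts [row_not_span]. *)
Lemma commuting_exponent0 (x : 'I_n -> int) :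
  (forall j, \prod_i q i j ^ x i = 1) -> forall i, x i = 0.
Proof.
move=> xC a; apply/eqP; apply: contraT => xa0; case: (@row_not_span a) => j ja.
apply: (power_span_root (q0 a j) xa0).
move: (xC j); rewrite (bigD1 a) //= => /(canRL (mulfK _)) -> //; last first.
  by apply/prodf_neq0 => i _; rewrite expfz_eq0 negb_and q0 orbT.
rewrite mul1r; apply: power_spanV.
apply: big_ind => [||i ia]; [exact: power_span1|exact: power_spanM|].
by apply: power_span_exp => //; apply: minor_span.
Qed.

(** If [b = s a] differs from [a], then [q a j = q b (s j)] expresses row [a] through
    row [b], whose entries avoid the index [a] unless [s j = a].  In that last case
    [q a j] is the inverse of [q a b], which is [q b (s b)]; should also [s b = a],
    then [q a b = q b a] has square [1]. *)
Lemma q_preserving_id (s : 'I_n -> 'I_n) :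
  (forall i j, q (s i) (s j) = q i j) -> s =1 id.
Proof.
move=> sq a; apply/eqP; apply: contraT => ba; set b := s a in ba.
have qbP c : c != a -> power_span (minor_gen a) (q b c) by apply: minor_span.
have qabP : power_span (minor_gen a) (q a b).
  have [sb|sb] := eqVneq (s b) a; last by rewrite -sq; apply: qbP.
  apply: (@power_span_root _ _ _ _ 2) => //.
  rewrite -exprnP expr2 -[X in X * _]sq sb -/b [X in X * _]qV mulVf //.
  exact: power_span1.
case: (@row_not_span a) => j ja; rewrite -sq -/b.
have [->|sj] := eqVneq (s j) a; last exact: qbP.
by rewrite qV; apply: power_spanV.
Qed.
End RankBound.

(** * Linear maps on monoid algebras *)

(** Serves to close a step of [malg_span]: rewriting with the induction hypotheses
    would first try to unify the two products occurring in the goal. *)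
Lemma linear_congr (R : nzRingType) (V : lmodType R) (c : R) (a b a' b' : V) :
  a = b -> a' = b' -> c *: a + a' = c *: b + b'.
Proof. by move=> -> ->. Qed.

Lemma scale_relator (R : comNzRingType) (V : lmodType R) (a b c : R) (x y : V) :
  (a * b) *: x - c *: ((b * a) *: y) = (a * b) *: (x - c *: y).
Proof. by rewrite scalerBr !scalerA (mulrC b a) (mulrC c). Qed.

Section LinearExtension.
Variables (F : fieldType) (K : choiceType).
Implicit Types x y : {malg F[K]}.

(** Sealed, so that comparing two basis vectors compares their indices only. *)
Definition basis : K -> {malg F[K]} := locked (fun k => << k >>).

Lemma basisE k : basis k = << k >>. Proof. by rewrite /basis -lock. Qed.

Lemma mcoeff_basis k l : (basis k)@_l = (k == l)%:R.
Proof. by rewrite basisE mcoeffU. Qed.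

Lemma malg_span (P : {malg F[K]} -> Prop) :
  P 0 -> (forall c x y, P x -> P y -> P (c *: x + y)) ->
  (forall k, P (basis k)) -> forall x, P x.
Proof.
move=> P0 PD PU x; rewrite [x]monalgE.
elim/big_ind: _ => [|y z Py Pz|k _] //; first by rewrite -[y]scale1r; apply: PD.
have -> : << x@_k *g k >> = x@_k *: basis k + 0 :> {malg F[K]}.
  by rewrite addr0 basisE; apply/malgP => l; rewrite mcoeffZ !mcoeffU mulr_natr.
exact: PD.
Qed.

Variables (V : lmodType F) (h : K -> V).

Definition linext x : V := \sum_(k <- msupp x) x@_k *: h k.

Lemma linextEw (d : {fset K}) x :
  (msupp x `<=` d)%fset -> linext x = \sum_(k <- d) x@_k *: h k.
Proof.
move=> le; rewrite [LHS](big_fset_incl _ le) // => k _ /mcoeff_outdom ->.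
by rewrite scale0r.
Qed.

Fact linext_is_linear : linear linext.
Proof.
move=> c x y; pose d := (msupp x `|` msupp y)%fset.
rewrite !(@linextEw d); last 3 first.
- exact: fsubsetUr.
- exact: fsubsetUl.
- by apply: fsubset_trans (msuppD_le _ _) _; apply: fsetSU; apply: msuppZ_le.
rewrite scaler_sumr -big_split /=; apply: eq_bigr => k _.
by rewrite mcoeffD mcoeffZ scalerDl scalerA.
Qed.

HB.instance Definition _ :=
  GRing.isLinear.Build F {malg F[K]} V _ linext linext_is_linear.

Lemma linextP c x y : linext (c *: x + y) = c *: linext x + linext y.
Proof. exact: linext_is_linear. Qed.

Lemma linext0 : linext 0 = 0. Proof. exact: linear0. Qed.

Lemma linextZ c x : linext (c *: x) = c *: linext x.
Proof. by have := linextP c x 0; rewrite linext0 !addr0. Qed.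

Lemma linextB x y : linext (x - y) = linext x - linext y.
Proof. exact: linearB. Qed.

Lemma linextU k : linext (basis k) = h k.
Proof. by rewrite basisE (linextEw msuppU_le) big_seq_fset1 mcoeffUU scale1r. Qed.

End LinearExtension.

Lemma eq_linext (F : fieldType) (K : choiceType) (V : lmodType F)
    (h1 h2 : K -> V) x :
  h1 =1 h2 -> linext h1 x = linext h2 x.
Proof. by move=> h12; apply: eq_bigr => k _; rewrite h12. Qed.

Lemma linext_linear_fun (F : fieldType) (K : choiceType) (V : lmodType F)
    (c : F) (h1 h2 : K -> V) x :
  linext (fun k => c *: h1 k + h2 k) x = c *: linext h1 x + linext h2 x.
Proof.
rewrite scaler_sumr -big_split; apply: eq_bigr => k _.
by rewrite scalerDr !scalerA mulrC.
Qed.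

Lemma mulmFMonom n (s t : seq 'I_n) :
  mmul (FMonom s) (FMonom t) = FMonom (s ++ t) :> {fmonom 'I_n}.
Proof. by rewrite -[mmul _ _]/(fmmul _ _) fmmulE. Qed.

Lemma basisM (K : monomType) (F : fieldType) (k l : K) :
  basis F k * basis F l = basis F (mmul k l).
Proof. by rewrite !basisE malgM_def fgmulUU mulr1. Qed.

Section FreeAlgebraBilinear.
Variables (F : fieldType) (n : nat).
Implicit Types x y z : free_algebra F n.

Definition word (s : seq 'I_n) : free_algebra F n := basis F (FMonom s).

Lemma wordM s t : word s * word t = word (s ++ t).
Proof. by rewrite /word basisM mulmFMonom. Qed.

Lemma free_varE (i : 'I_n) : free_var F i = word [:: i].
Proof. by rewrite /word basisE -fmuE. Qed.

Lemma word_nil : word [::] = 1.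
Proof. by rewrite /word basisE -fmoneE. Qed.

Lemma free_span (P : free_algebra F n -> Prop) :
  P 0 -> (forall c x y, P x -> P y -> P (c *: x + y)) ->
  (forall s, P (word s)) -> forall x, P x.
Proof. by move=> P0 PD PU; apply: malg_span => // -[s]; apply: PU. Qed.

Lemma free_mulPl c x y z : (c *: x + y) * z = c *: (x * z) + y * z.
Proof. by rewrite mulrDl scalerAl. Qed.

Lemma free_mulPr c x y z : z * (c *: x + y) = c *: (z * x) + z * y.
Proof. by rewrite mulrDr free_scalerAr. Qed.
End FreeAlgebraBilinear.

Notation exponent n := {ffun 'I_n -> nat}.

(** * Commutation bicharacters *)

Section Bicharacter.
Variables (F : fieldType) (n : nat) (q : 'M[F]_n).
Implicit Types u v w : exponent n.

Definition unit_exp (i : 'I_n) : exponent n := [ffun j => (j == i : nat)].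

(** The bicharacter governing the product of ordered monomials:
    [X^u X^v = reorder u v * X^(u+v)], one factor [q i j] for each [X_i] of [X^u] that
    has to move past an [X_j] of [X^v] with [j < i]. *)
Definition reorder u v : F :=
  \prod_(i < n) \prod_(j < n | (j < i)%N) q i j ^+ (u i * v j).

Definition commutation u v : F := \prod_i \prod_j q i j ^+ (u i * v j).

Lemma reorderDl u v w : reorder (u + v) w = reorder u w * reorder v w.
Proof.
rewrite -big_split; apply: eq_bigr => i _; rewrite -big_split.
by apply: eq_bigr => j _; rewrite ffunE mulnDl exprD.
Qed.

Lemma reorderDr u v w : reorder u (v + w) = reorder u v * reorder u w.
Proof.
rewrite -big_split; apply: eq_bigr => i _; rewrite -big_split.
by apply: eq_bigr => j _; rewrite ffunE mulnDr exprD.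
Qed.

Lemma reorder0r u : reorder u 0 = 1.
Proof.
by rewrite /reorder big1 // => i _; rewrite big1 // => j _; rewrite ffunE muln0.
Qed.

Lemma commutationDl u v w : commutation (u + v) w = commutation u w * commutation v w.
Proof.
rewrite -big_split; apply: eq_bigr => i _; rewrite -big_split.
by apply: eq_bigr => j _; rewrite ffunE mulnDl exprD.
Qed.

Lemma commutation0l u : commutation 0 u = 1.
Proof.
by rewrite /commutation big1 // => i _; rewrite big1 // => j _; rewrite ffunE.
Qed.

Lemma commutation_unitr u j : commutation u (unit_exp j) = \prod_i q i j ^+ u i.
Proof.
apply: eq_bigr => i _; rewrite (bigD1 j) //= ffunE eqxx muln1.
by rewrite big1 ?mulr1 // => k /negPf kj; rewrite ffunE kj muln0.
Qed.

Lemma commutation_unit i j : commutation (unit_exp i) (unit_exp j) = q i j.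
Proof.
rewrite commutation_unitr (bigD1 i) //= ffunE eqxx.
by rewrite big1 ?mulr1 // => k /negPf ki; rewrite ffunE ki.
Qed.

Hypothesis q_antisym : mult_antisymmetric q.
Let q0 i j : q i j != 0. Proof. by case: q_antisym. Qed.
Let qii i : q i i = 1. Proof. by case: q_antisym. Qed.
Let qV i j : q j i = (q i j)^-1. Proof. by case: q_antisym. Qed.

Lemma reorder_neq0 u v : reorder u v != 0.
Proof. by apply/prodf_neq0 => i _; apply/prodf_neq0 => j _; rewrite expf_neq0. Qed.

(** The factors with [i < j] of the commutation bicharacter cancel those of
    [reorder v u] because [q j i] is the inverse of [q i j]; the diagonal ones
    are [1]. *)
Lemma reorderC u v : reorder u v = commutation u v * reorder v u.
Proof.
rewrite /reorder [X in _ * X](exchange_big_dep xpredT) //= -big_split /=.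
apply: eq_bigr => i _; rewrite [X in _ = X * _](bigID (fun j : 'I_n => (j < i)%N)) /=.
rewrite -mulrA [X in _ * X](_ : _ = 1) ?mulr1 //.
rewrite (bigD1 i) /=; last by rewrite ltnn.
rewrite qii expr1n mul1r (eq_bigl (fun j : 'I_n => (i < j)%N)) => [|j]; last first.
  by rewrite -leqNgt ltn_neqAle eq_sym andbC.
rewrite -big_split big1 // => j _; rewrite (qV i j) mulnC exprVn /=.
by rewrite mulnC mulfV // expf_neq0.
Qed.
End Bicharacter.

(** * Normal forms of the quantum affine space *)

Section NormalForm.
Variables (F : fieldType) (n : nat) (q : 'M[F]_n).
Hypothesis q_antisym : mult_antisymmetric q.
Local Notation E := (exponent n).
Local Notation A := (qaffine_space q).
Local Notation beta := (reorder q).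
Local Notation "\X_ i" := (unit_exp i) (at level 8, i at level 2).

(** The product of the quantum affine space in the basis of ordered monomials. *)
Definition twmul (f g : {malg F[E]}) : {malg F[E]} :=
  locked (linext (fun u => linext (fun v => beta u v *: basis F (u + v)) g) f).

Lemma twmulE f g :
  twmul f g = linext (fun u => linext (fun v => beta u v *: basis F (u + v)) g) f.
Proof. by rewrite /twmul -lock. Qed.

Lemma twmulUU u v : twmul (basis F u) (basis F v) = beta u v *: basis F (u + v).
Proof. by rewrite twmulE !linextU. Qed.

Lemma twmulPl c f1 f2 g : twmul (c *: f1 + f2) g = c *: twmul f1 g + twmul f2 g.
Proof. by rewrite !twmulE linextP. Qed.

Lemma twmulPr c f g1 g2 : twmul f (c *: g1 + g2) = c *: twmul f g1 + twmul f g2.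
Proof.
rewrite !twmulE -linext_linear_fun; apply: eq_linext => u; exact: linext_is_linear.
Qed.

Lemma twmul0l g : twmul 0 g = 0. Proof. by rewrite twmulE linext0. Qed.

Lemma twmul0r f : twmul f 0 = 0.
Proof. by have := twmulPr (-1) f 0 0; rewrite scaler0 addr0 scaleN1r addNr. Qed.

Lemma twmulZl c f g : twmul (c *: f) g = c *: twmul f g.
Proof. by have := twmulPl c f 0 g; rewrite twmul0l !addr0. Qed.

Lemma twmulZr c f g : twmul f (c *: g) = c *: twmul f g.
Proof. by have := twmulPr c f g 0; rewrite twmul0r !addr0. Qed.

Definition content (s : seq 'I_n) : E := [ffun i => count_mem i s].

Lemma content_cons i s : content (i :: s) = \X_i + content s.
Proof. by apply/ffunP => j; rewrite !ffunE /= eq_sym. Qed.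

Lemma content_cat s t : content (s ++ t) = content s + content t.
Proof. by apply/ffunP => j; rewrite !ffunE count_cat. Qed.

Lemma content_nil : content [::] = 0.
Proof. by apply/ffunP => j; rewrite !ffunE. Qed.

(** The scalar relating a product of variables to the ordered monomial with the same
    content; see [nf_word_prod]. *)
Fixpoint sort_factor (s : seq 'I_n) : F :=
  if s is i :: s' then beta \X_i (content s') * sort_factor s' else 1.

Lemma sort_factor_cat s t : sort_factor (s ++ t) =
  beta (content s) (content t) * (sort_factor s * sort_factor t).
Proof.
elim: s => [|i s IH] /=.
  rewrite !mul1r content_nil (reorderC q_antisym) commutation0l.
  by rewrite reorder0r mulr1 mul1r.
by rewrite IH content_cat content_cons reorderDl reorderDr; ring.
Qed.

Lemma sort_factor_neq0 s : sort_factor s != 0.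
Proof.
by elim: s => [|i s IH] /=; rewrite ?oner_neq0 // mulf_neq0 // reorder_neq0.
Qed.

Definition free_nf : free_algebra F n -> {malg F[E]} :=
  linext (fun w : {fmonom 'I_n} => sort_factor w *: basis F (content w)).

Lemma free_nfP c x y : free_nf (c *: x + y) = c *: free_nf x + free_nf y.
Proof. exact: linext_is_linear. Qed.

Lemma free_nf0 : free_nf 0 = 0. Proof. exact: linext0. Qed.

Lemma free_nfZ c x : free_nf (c *: x) = c *: free_nf x.
Proof. exact: linextZ. Qed.

Lemma free_nfB x y : free_nf (x - y) = free_nf x - free_nf y.
Proof. exact: linextB. Qed.

Lemma free_nfU s : free_nf (word F s) = sort_factor s *: basis F (content s).
Proof. exact: linextU. Qed.

Lemma free_nfM x y : free_nf (x * y) = twmul (free_nf x) (free_nf y).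
Proof.
elim/free_span: x => [|c x x' Hx Hx'|s].
- by rewrite mul0r free_nf0 twmul0l.
- rewrite free_mulPl !free_nfP twmulPl; exact: linear_congr Hx Hx'.
elim/free_span: y => [|c y y' Hy Hy'|t].
- by rewrite mulr0 free_nf0 twmul0r.
- rewrite free_mulPr !free_nfP twmulPr; exact: linear_congr Hy Hy'.
rewrite wordM !free_nfU sort_factor_cat content_cat.
rewrite twmulZl twmulZr twmulUU !scalerA; congr (_ *: _).
by ring.
Qed.

(** Hence normal forms descend to the quotient; this is the linear independence half
    of the basis theorem for ordered monomials. *)
Lemma free_nf_ideal x : x \in qideal q -> free_nf x = 0.
Proof.
move=> /qidealP; elim=> [y [i [j ->]]||y z _ hy _ hz|a y _ IH|a y _ IH].
- rewrite free_nfB free_nfZ !free_varE !wordM !free_nfU /=.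
  rewrite !content_cons content_nil !addr0 !mulr1 !reorder0r !mulr1 !scalerA.
  rewrite (reorderC q_antisym \X_i) commutation_unit.
  by rewrite (addrC \X_i) subrr.
- exact: free_nf0.
- by rewrite free_nfB hy hz subrr.
- by rewrite free_nfM IH twmul0r.
- by rewrite free_nfM IH twmul0l.
Qed.

Lemma qspace_pi_linear c (x y : free_algebra F n) :
  \pi_A (c *: x + y) = c *: \pi_A x + \pi_A y.
Proof. by rewrite -qspace_piZ rmorphD. Qed.

(** The coordinates of an element in the basis of ordered monomials. *)
Definition nf (a : A) : {malg F[E]} := free_nf (repr a).

Lemma nf_pi x : nf (\pi x) = free_nf x.
Proof.
apply/eqP; rewrite -subr_eq0 -free_nfB; apply/eqP/free_nf_ideal.
by rewrite -opprB rpredN; apply: qspace_reprP.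
Qed.

Lemma qspace_ind (P : A -> Prop) : (forall x, P (\pi x)) -> forall a, P a.
Proof. by move=> H a; rewrite -[a]reprK. Qed.

Lemma nfP c a b : nf (c *: a + b) = c *: nf a + nf b.
Proof.
elim/qspace_ind: a => x; elim/qspace_ind: b => y.
by rewrite -qspace_pi_linear !nf_pi free_nfP.
Qed.

Lemma nf0 : nf 0 = 0.
Proof. by rewrite -(rmorph0 \pi_A) nf_pi free_nf0. Qed.

Lemma nfZ c a : nf (c *: a) = c *: nf a.
Proof. by have := nfP c a 0; rewrite nf0 !addr0. Qed.

Lemma nfM a b : nf (a * b) = twmul (nf a) (nf b).
Proof.
elim/qspace_ind: a => x; elim/qspace_ind: b => y.
by rewrite -rmorphM !nf_pi free_nfM.
Qed.

Lemma nf_qcommute a b c :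
  a * b = c *: (b * a) -> twmul (nf a) (nf b) = c *: twmul (nf b) (nf a).
Proof. by rewrite -!nfM -nfZ => ->. Qed.

Definition word_prod (s : seq 'I_n) : A := \prod_(i <- s) qvar q i.

Lemma word_prodE s : word_prod s = \pi_A (word F s).
Proof.
elim: s => [|i s IH]; first by rewrite /word_prod big_nil word_nil rmorph1.
by rewrite /word_prod big_cons -/(word_prod s) IH /qvar free_varE -rmorphM wordM.
Qed.

Lemma nf_word_prod s : nf (word_prod s) = sort_factor s *: basis F (content s).
Proof. by rewrite word_prodE nf_pi free_nfU. Qed.

Lemma nf_qvar i : nf (qvar q i) = basis F \X_i.
Proof.
have := nf_word_prod [:: i]; rewrite /word_prod big_seq1 /= => ->.
by rewrite content_cons content_nil reorder0r addr0 mul1r scale1r.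
Qed.

(** A product of variables rescaled so as to depend on its content only; it equals
    the ordered monomial.  With this description, ordered products need not be handled
    explicitly. *)
Definition word_monomial s : A := (sort_factor s)^-1 *: word_prod s.

Lemma word_monomial_cons i s :
  word_monomial (i :: s) = (beta \X_i (content s))^-1 *: (qvar q i * word_monomial s).
Proof. by rewrite /word_monomial /word_prod big_cons /= invfM -scalerAr scalerA. Qed.

Lemma word_monomial_swap i j s :
  word_monomial (i :: j :: s) = word_monomial (j :: i :: s).
Proof.
have word_monomial_cons2 k l : word_monomial (k :: l :: s) =
    (beta \X_k (\X_l + content s) * beta \X_l (content s))^-1 *:
      (qvar q k * (qvar q l * word_monomial s)).
  rewrite word_monomial_cons content_cons word_monomial_cons invfM.
  by rewrite -(scalerAr _ (qvar q k)) scalerA.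
rewrite (word_monomial_cons2 i j) (word_monomial_cons2 j i) (mulrA (qvar q i)) qvarM.
rewrite -scalerAl -mulrA scalerA.
apply: (congr1 (fun c => c *: (qvar q j * (qvar q i * word_monomial s)))).
rewrite !reorderDr (reorderC q_antisym \X_i \X_j) commutation_unit.
have [q0 _ _] := q_antisym.
have := q0 i j; have := reorder_neq0 q_antisym \X_j \X_i.
have := reorder_neq0 q_antisym \X_j (content s).
have := reorder_neq0 q_antisym \X_i (content s).
move: (beta _ _) (beta _ _) (beta _ _) (q i j) => x y z t x0 y0 z0 t0.
by field; rewrite x0 y0 z0 t0.
Qed.

(** Bubble sort: swapping two adjacent variables changes the product by [q i j], and
    the rescaling absorbs it ([word_monomial_swap]). *)
Lemma word_monomial_perm s t : perm_eq s t -> word_monomial s = word_monomial t.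
Proof.
have cong i s1 s2 : perm_eq s1 s2 -> word_monomial s1 = word_monomial s2 ->
    word_monomial (i :: s1) = word_monomial (i :: s2).
  move=> /permP p12 e12; rewrite !word_monomial_cons e12.
  suff -> : content s1 = content s2 by [].
  by apply/ffunP => j; rewrite !ffunE p12.
have front i t1 t2 : word_monomial (i :: t1 ++ t2) = word_monomial (t1 ++ i :: t2).
  elim: t1 => //= j t1 IH; rewrite word_monomial_swap; apply: cong IH.
  by rewrite -cat1s perm_catCA.
elim: s t => [|i s IH] t; first by rewrite perm_sym => /perm_nilP ->.
move=> pst; have it : i \in t by rewrite -(perm_mem pst) mem_head.
case/splitPr: it pst => t1 t2 pst; have ps : perm_eq s (t1 ++ t2).
  rewrite -(perm_cons i); apply: perm_trans pst _.
  by rewrite -[i :: t2]cat1s perm_catCA.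
by rewrite -front; apply: cong (IH _ ps).
Qed.

Definition sorted_word (u : E) : seq 'I_n :=
  flatten [seq nseq (u i) i | i <- enum 'I_n].

Definition monomial (u : E) : A := word_monomial (sorted_word u).

Lemma content_sorted (u : E) : content (sorted_word u) = u.
Proof.
apply/ffunP => i; rewrite ffunE count_flatten -map_comp.
rewrite (eq_map (_ : _ =1 fun j : 'I_n => (j == i) * u j)%N) => [|j]; last first.
  by rewrite /= count_nseq.
rewrite sumnE big_map big_enum (bigD1 i) //= eqxx mul1n.
by rewrite big1 ?addn0 // => j /negPf ->.
Qed.

Lemma monomial_content s : monomial (content s) = word_monomial s.
Proof.
apply: word_monomial_perm; apply/allP => i _ /=; apply/eqP.
by have /ffunP/(_ i) := content_sorted (content s); rewrite !ffunE.
Qed.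

(** The ordered monomials span: this is the other half of the basis theorem, and it
    makes [nf] injective. *)
Lemma nf_expand a : a = linext monomial (nf a).
Proof.
elim/qspace_ind: a => x; rewrite nf_pi.
elim/free_span: x => [|c x y Hx Hy|s]; first by rewrite free_nf0 linext0 rmorph0.
  rewrite qspace_pi_linear free_nfP linextP; exact: linear_congr Hx Hy.
rewrite free_nfU linextZ linextU monomial_content /word_monomial scalerA -word_prodE.
by rewrite mulfV ?scale1r // sort_factor_neq0.
Qed.

Lemma nf_inj : injective nf.
Proof. by move=> a b eab; rewrite (nf_expand a) eab -nf_expand. Qed.

Lemma nf_eq0 a : (nf a == 0) = (a == 0).
Proof. by rewrite -[X in _ == X]nf0 (inj_eq nf_inj). Qed.

Lemma qvar_neq0 i : qvar q i != 0.
Proof.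
rewrite -nf_eq0 nf_qvar; apply/eqP => /(congr1 (mcoeff \X_i)) /eqP.
by rewrite mcoeff_basis eqxx mcoeff0 oner_eq0.
Qed.

End NormalForm.

(** * The torus action *)

Section TorusAction.
Variables (F : fieldType) (n : nat) (q : 'M[F]_n).
Local Notation A := (qaffine_space q).

Definition free_torus (a : 'I_n -> F) : free_algebra F n -> free_algebra F n :=
  linext (fun w : {fmonom 'I_n} => (\prod_(i <- w) a i) *: basis F w).

Lemma free_torusP a c x y :
  free_torus a (c *: x + y) = c *: free_torus a x + free_torus a y.
Proof. exact: linext_is_linear. Qed.

Lemma free_torus0 a : free_torus a 0 = 0. Proof. exact: linext0. Qed.

Lemma free_torusB a x y : free_torus a (x - y) = free_torus a x - free_torus a y.
Proof. exact: linextB. Qed.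

Lemma free_torusZ a c x : free_torus a (c *: x) = c *: free_torus a x.
Proof. exact: linextZ. Qed.

Lemma free_torusU a s :
  free_torus a (word F s) = (\prod_(i <- s) a i) *: word F s.
Proof. exact: linextU. Qed.

Lemma free_torusM a x y : free_torus a (x * y) = free_torus a x * free_torus a y.
Proof.
elim/free_span: x => [|c x x' Hx Hx'|s]; first by rewrite mul0r free_torus0 mul0r.
  rewrite free_mulPl !free_torusP free_mulPl; exact: linear_congr Hx Hx'.
elim/free_span: y => [|c y y' Hy Hy'|t]; first by rewrite mulr0 free_torus0 mulr0.
  rewrite free_mulPr !free_torusP free_mulPr; exact: linear_congr Hy Hy'.
rewrite wordM !free_torusU -scalerAl -free_scalerAr scalerA.
by rewrite wordM big_cat.
Qed.

Lemma free_torus_ideal a x : x \in qideal q -> free_torus a x \in qideal q.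
Proof.
move=> /qidealP; elim=> [y [i [j ->]]||y z _ hy _ hz|b y _ IH|b y _ IH].
- rewrite free_torusB free_torusZ !free_varE !wordM !free_torusU !big_cons !big_nil.
  rewrite !mulr1 scale_relator.
  apply/qideal_scale/qidealP/ideal_gen.
  by exists i, j; rewrite !free_varE !wordM.
- by rewrite free_torus0 rpred0.
- rewrite free_torusB; exact: rpredB hy hz.
- by rewrite free_torusM qideal_mull.
- by rewrite free_torusM qideal_mulr.
Qed.

Lemma free_torus_comp a b x :
  free_torus a (free_torus b x) = free_torus (fun i => a i * b i) x.
Proof.
elim/free_span: x => [|c x y Hx Hy|s]; first by rewrite !free_torus0.
  rewrite !free_torusP; exact: linear_congr Hx Hy.
by rewrite !free_torusU free_torusZ free_torusU scalerA big_split mulrC.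
Qed.

Lemma free_torus_id a x : (forall i, a i = 1) -> free_torus a x = x.
Proof.
move=> a1; elim/free_span: x => [|c x y Hx Hy|s]; first by rewrite free_torus0.
  rewrite free_torusP; exact: linear_congr Hx Hy.
by rewrite free_torusU big1 ?scale1r.
Qed.

Definition torus (a : 'I_n -> F) (x : A) : A := \pi_A (free_torus a (repr x)).

Lemma torus_pi a x : torus a (\pi_A x) = \pi_A (free_torus a x).
Proof.
apply/eqP; rewrite qspace_piE -free_torusB; apply: free_torus_ideal.
by rewrite -opprB rpredN; apply: qspace_reprP.
Qed.

Fact torus_is_linear a : linear (torus a).
Proof.
move=> c; elim/qspace_ind => x; elim/qspace_ind => y.
by rewrite -qspace_pi_linear !torus_pi free_torusP qspace_pi_linear.
Qed.

HB.instance Definition _ a :=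
  GRing.isLinear.Build F A A _ (torus a) (torus_is_linear a).

Fact torus_is_monoid_morphism a : monoid_morphism (torus a).
Proof.
split; last first.
  elim/qspace_ind => x; elim/qspace_ind => y.
  by rewrite -rmorphM !torus_pi free_torusM rmorphM.
rewrite -(rmorph1 \pi_A) torus_pi; congr (\pi_A _).
by rewrite -(word_nil F n) free_torusU big_nil scale1r.
Qed.

HB.instance Definition _ a :=
  GRing.isMonoidMorphism.Build A A (torus a) (torus_is_monoid_morphism a).

Lemma torus_qvar a i : torus a (qvar q i) = a i *: qvar q i.
Proof. by rewrite /qvar torus_pi free_varE free_torusU big_seq1 qspace_piZ. Qed.

Lemma torusK a b : (forall i, b i * a i = 1) -> cancel (torus a) (torus b).
Proof.
move=> ba1; elim/qspace_ind => x.
rewrite !torus_pi free_torus_comp (free_torus_id _ ba1).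
exact: reprK.
Qed.

Lemma torus_bij a : (forall i, a i != 0) -> bijective (torus a).
Proof.
move=> a0; exists (torus (fun i => (a i)^-1)); apply: torusK => i.
  by rewrite mulVf.
by rewrite mulfV.
Qed.
End TorusAction.

(** * Leading exponents *)

Definition translation_order n (lt : rel (exponent n)) : Prop :=
  [/\ irreflexive lt, transitive lt, forall u v, u != v -> lt u v || lt v u
    & forall w u v, lt u v -> lt (u + w) (v + w)].

Section LeadingExponents.
Variables (F : fieldType) (n : nat) (lt : rel (exponent n)).
Hypothesis lt_order : translation_order lt.
Implicit Types (f g : {malg F[exponent n]}) (u v : exponent n).

Let lt_irr : irreflexive lt. Proof. by case: lt_order. Qed.
Let lt_trans : transitive lt. Proof. by case: lt_order. Qed.
Let lt_total u v : u != v -> lt u v || lt v u.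
Proof. by case: lt_order => _ _ + _; apply. Qed.
Let lt_addr w u v : lt u v -> lt (u + w) (v + w).
Proof. by case: lt_order => _ _ _; apply. Qed.

Definition leading f u : Prop :=
  f@_u != 0 /\ forall v, v != u -> f@_v != 0 -> lt v u.

Lemma leading_uniq f u v : leading f u -> leading f v -> u = v.
Proof.
move=> [fu Hu] [fv Hv]; apply/eqP; apply: contraT => uv.
by have := lt_trans (Hv _ uv fu) (Hu _ _ fv); rewrite lt_irr eq_sym => /(_ uv).
Qed.

Lemma leadingU u : leading (basis F u) u.
Proof.
split=> [|v /negPf vu]; first by rewrite mcoeff_basis eqxx oner_neq0.
by rewrite mcoeff_basis (eq_sym u) vu eqxx.
Qed.

Lemma leadingZ c f u : c != 0 -> leading f u -> leading (c *: f) u.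
Proof.
move=> c0 [fu Hu]; split=> [|v vu]; rewrite mcoeffZ mulf_eq0 negb_or c0 //=.
exact: Hu.
Qed.

Lemma leadingD f g u v : leading f u -> leading g v -> lt v u -> leading (f + g) u.
Proof.
move=> [fu Hu] [gv Hv] vu; split=> [|w wu].
  suff /eqP gu0 : g@_u == 0 by rewrite mcoeffD gu0 addr0.
  apply: contraT => gu; have uv : u != v by apply: contraTneq vu => ->; rewrite lt_irr.
  by have := lt_trans (Hv _ uv gu) vu; rewrite lt_irr.
rewrite mcoeffD; have [->|fw _] := eqVneq f@_w 0; last exact: Hu.
rewrite add0r => gw; have [->//|wv] := eqVneq w v.
by apply: lt_trans vu; apply: Hv.
Qed.

Lemma leading_ex f : f != 0 -> exists u, leading f u.
Proof.
have seq_max (s : seq (exponent n)) : s != [::] ->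
    exists2 u, u \in s & forall v, v != u -> v \in s -> lt v u.
  elim: s => // x [|y s] IH _.
    by exists x => [|v /negPf vx]; rewrite inE ?vx.
  have [u us Hu] := IH isT.
  have [xu|xu] := eqVneq x u.
    exists u => [|v vu]; rewrite in_cons ?us ?orbT // => /predU1P[vx|]; last exact: Hu.
    by rewrite vx xu eqxx in vu.
  case/orP: (lt_total xu) => [lxu|lux].
    exists u => [|v vu]; rewrite in_cons ?us ?orbT // => /predU1P[->//|]; exact: Hu.
  exists x => [|v vx]; rewrite in_cons ?eqxx // (negPf vx) => vs.
  by have [->//|vu] := eqVneq v u; apply: lt_trans lux; apply: Hu.
move=> f0; have [|u us Hu] := seq_max (msupp f).
  by apply: contraNneq f0 => s0; rewrite [f]monalgE s0 big_nil.
by exists u; split=> [|v vu]; rewrite mcoeff_neq0 //; apply: Hu.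
Qed.

(** Leading terms with distinct exponents cannot cancel. *)
Lemma leading_sum (I : eqType) (s : seq I) (f : I -> {malg F[exponent n]})
    (t : I -> exponent n) :
  injective t -> (forall i, i \in s -> leading (f i) (t i)) -> uniq s -> s != [::] ->
  exists2 i, i \in s & leading (\sum_(i <- s) f i) (t i).
Proof.
move=> t_inj; elim: s => // x [|y s] IH Hs.
  by exists x; rewrite ?mem_head // big_seq1; apply: Hs; apply: mem_head.
rewrite cons_uniq => /andP[xs us] _; have [|//|//|z zs Hz] := IH.
  by move=> i si; apply: Hs; rewrite inE si orbT.
have Hx := Hs x (mem_head _ _); rewrite big_cons.
have xz : x != z by apply: contraNneq xs => ->.
have /lt_total/orP[lxz|lzx] : t x != t z by rewrite (inj_eq t_inj).
  by exists z; rewrite 1?inE ?zs ?orbT // addrC; apply: leadingD lxz.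
by exists x; rewrite ?mem_head //; apply: leadingD lzx.
Qed.

Lemma lt_add u v a b : (a == u) || lt a u -> (b == v) || lt b v ->
  (a, b) != (u, v) -> lt (a + b) (u + v).
Proof.
rewrite xpair_eqE; have [->|_] /= := eqVneq a u => lau.
  by have [//|_ lbv _] := eqVneq b v; rewrite !(addrC u); apply: lt_addr.
move=> /predU1P[->|lbv] _; first exact: lt_addr.
by apply: lt_trans (lt_addr b lau) _; rewrite !(addrC u); apply: lt_addr.
Qed.

Variable q : 'M[F]_n.
Hypothesis q_antisym : mult_antisymmetric q.

Lemma mcoeff_twmul f g w : (twmul q f g)@_w =
  \sum_(a <- msupp f) \sum_(b <- msupp g)
    f@_a * (g@_b * (reorder q a b * (a + b == w)%:R)).
Proof.
rewrite twmulE /linext raddf_sum; apply: eq_bigr => a _.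
rewrite /= mcoeffZ raddf_sum /= mulr_sumr; apply: eq_bigr => b _.
by rewrite !mcoeffZ mcoeff_basis.
Qed.

Lemma leading_supp f u a : leading f u -> a \in msupp f -> (a == u) || lt a u.
Proof. by case=> _ Hu; rewrite -mcoeff_neq0; have [//|au] := eqVneq a u; exact: Hu. Qed.

(** By [lt_add], only the pair of leading exponents contributes to the coefficient
    at their sum. *)
Lemma mcoeff_twmul_leading f g u v : leading f u -> leading g v ->
  (twmul q f g)@_(u + v) = f@_u * g@_v * reorder q u v.
Proof.
move=> Hu Hv; have [fu _] := Hu; have [gv _] := Hv.
have other a b : a \in msupp f -> b \in msupp g -> (a, b) != (u, v) ->
    (a + b == u + v) = false.
  move=> fa gb /(lt_add (leading_supp Hu fa) (leading_supp Hv gb)) lt_ab.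
  by apply: contraTF lt_ab => /eqP ->; rewrite lt_irr.
rewrite mcoeff_twmul (bigD1_seq u) ?fset_uniq -?mcoeff_neq0 //=.
rewrite (bigD1_seq v) ?fset_uniq -?mcoeff_neq0 //= eqxx mulr1 mulrA.
rewrite big_seq_cond big1 ?addr0 => [|b /andP[gb bv]]; last first.
  rewrite other ?mulr0 // -?mcoeff_neq0 //.
  by rewrite xpair_eqE negb_and bv orbT.
rewrite big_seq_cond big1 ?addr0 // => a /andP[fa au].
rewrite big_seq big1 // => b gb; rewrite other ?mulr0 //.
by rewrite xpair_eqE negb_and au.
Qed.

Lemma leading_twmul f g u v :
  leading f u -> leading g v -> leading (twmul q f g) (u + v).
Proof.
move=> Hu Hv; have [fu _] := Hu; have [gv _] := Hv; split=> [|w wuv].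
  by rewrite (mcoeff_twmul_leading Hu Hv) !mulf_neq0 ?reorder_neq0.
apply: contraNT => nlt; rewrite mcoeff_twmul big_seq big1 // => a fa.
rewrite big_seq big1 // => b gb; case: eqVneq => [abw|_]; last by rewrite !mulr0.
case/negP: nlt; rewrite -abw; apply: lt_add.
- exact: leading_supp fa.
- exact: leading_supp gb.
- by apply: contraNneq wuv => -[au bv]; rewrite -abw au bv.
Qed.

(** Compare the coefficients at [u + v] and cancel the leading ones: what is left is
    [reorder q u v = c * reorder q v u]. *)
Lemma commutation_leading f g u v c : leading f u -> leading g v ->
  twmul q f g = c *: twmul q g f -> commutation q u v = c.
Proof.
move=> Hu Hv fg_comm; have := mcoeff_twmul_leading Hu Hv.
rewrite fg_comm (mcoeffZ c (twmul q g f)) addrC (mcoeff_twmul_leading Hv Hu).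
rewrite (reorderC q_antisym u).
move=> E; have [fu _] := Hu; have [gv _] := Hv.
apply: (mulIf (mulf_neq0 (mulf_neq0 fu gv) (reorder_neq0 q_antisym v u))).
by rewrite mulrCA -E (mulrC g@_v).
Qed.
End LeadingExponents.

(** * Leading exponents of the images of the monomials *)

Section LeadingImages.
Variables (F : fieldType) (n : nat) (q : 'M[F]_n).
Hypothesis q_antisym : mult_antisymmetric q.
Variable phi : {lrmorphism qaffine_space q -> qaffine_space q}.
Variable lt : rel (exponent n).
Hypothesis lt_order : translation_order lt.
Variable m : 'I_n -> exponent n.
Hypothesis leading_m : forall i, leading lt (nf (phi (qvar q i))) (m i).

(** The leading exponent of the image of the monomial with exponent [u]; see
    [leading_phi_monomial]. *)
Definition image_exp (u : exponent n) : exponent n := \sum_i m i *+ u i.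

Lemma image_expD u v : image_exp (u + v) = image_exp u + image_exp v.
Proof.
by rewrite -big_split; apply: eq_bigr => l _; rewrite ffunE mulrnDr.
Qed.

Lemma image_exp0 : image_exp 0 = 0.
Proof. by rewrite /image_exp big1 // => i _; rewrite ffunE. Qed.

Lemma image_exp_unit i : image_exp (unit_exp i) = m i.
Proof.
rewrite /image_exp (bigD1 i) //= ffunE eqxx big1 ?addr0 // => j /negPf ji.
by rewrite ffunE ji.
Qed.

Lemma commutation_m i j : commutation q (m i) (m j) = q i j.
Proof.
apply: (commutation_leading lt_order q_antisym (leading_m i) (leading_m j)).
apply: (nf_qcommute q_antisym); rewrite -!(rmorphM phi) qvarM; exact: linearZ.
Qed.

Lemma commutation_image_exp u j :
  commutation q (image_exp u) (m j) = \prod_i q i j ^+ u i.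
Proof.
rewrite (big_morph _ (fun x y => commutationDl q x y (m j)) (commutation0l q _)).
apply: eq_bigr => i _; rewrite -commutation_m; elim: (u i) => [|k IH].
  by rewrite commutation0l.
by rewrite mulrS commutationDl IH exprS.
Qed.

Lemma leading_phi_word_prod s :
  leading lt (nf (phi (word_prod q s))) (image_exp (content s)).
Proof.
elim: s => [|i s IH].
  rewrite /word_prod big_nil rmorph1; have := nf_word_prod q_antisym [::].
  rewrite /word_prod big_nil => -> /=; rewrite scale1r content_nil.
  rewrite image_exp0; exact: leadingU.
rewrite /word_prod big_cons -/(word_prod q s) rmorphM (nfM q_antisym) content_cons.
rewrite image_expD image_exp_unit.
exact: (leading_twmul lt_order q_antisym (leading_m i) IH).
Qed.

Lemma leading_phi_monomial u : leading lt (nf (phi (monomial q u))) (image_exp u).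
Proof.
rewrite /monomial /word_monomial linearZ (nfZ q_antisym); apply: leadingZ.
  by rewrite invr_eq0 sort_factor_neq0.
rewrite -[X in leading _ _ (image_exp X)]content_sorted.
exact: leading_phi_word_prod.
Qed.

Lemma nf_phi_linext (h : exponent n -> qaffine_space q) (g : {malg F[exponent n]}) :
  nf (phi (linext h g)) = linext (fun u => nf (phi (h u))) g.
Proof.
elim/malg_span: g => [|c f g Hf Hg|u]; last by rewrite !linextU.
  by rewrite !linext0 (rmorph0 phi) (nf0 q_antisym).
rewrite !linextP (linearP phi) (nfP q_antisym); exact: linear_congr Hf Hg.
Qed.

(** When vectors of natural numbers add up to a unit vector, one of them is that unit
    vector; being a multiple [u i] of [m i], it has [u i = 1]. *)
Lemma image_exp_eq_unit u k : unit_exp k = image_exp u ->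
  exists i, m i = unit_exp k.
Proof.
move=> uk; have mE l : (\sum_i m i l * u i)%N = (l == k).
  have /ffunP/(_ l) := uk; rewrite ffunE sum_ffunE => ->.
  apply: eq_bigr => i _; rewrite ffunMnE.
  by elim: (u i) => [|c IH]; rewrite ?muln0 // mulrS -IH mulnS.
have [i mik] : exists i, (m i k * u i != 0)%N.
  apply/existsP; apply: contraPT (mE k) => /existsPn no.
  by rewrite big1 ?eqxx // => i _; apply/eqP; rewrite -[_ == _]negbK.
have le l : (m i l * u i <= (l == k))%N by rewrite -mE (bigD1 i) //= leq_addr.
have /andP[/eqP mik1 /eqP ui1] : (m i k == 1%N) && (u i == 1%N).
  by rewrite -muln_eq1 eqn_leq lt0n mik andbT; have := le k; rewrite eqxx.
exists i; apply/ffunP => l; rewrite ffunE.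
have := le l; rewrite ui1 muln1; have [->|_] := eqVneq l k; first by [].
by rewrite leqn0 => /eqP.
Qed.

(** [X_k] is the image of some [a], and the monomials of [a] have images with distinct
    leading exponents.  The largest of these is the exponent of [X_k]. *)
Lemma unit_exp_is_leading : injective image_exp ->
  (forall b, exists a, phi a = b) -> forall k, exists i, m i = unit_exp k.
Proof.
move=> image_exp_inj phi_surj k; have [a phi_a] := phi_surj (qvar q k).
have lead_k : leading lt (nf (qvar q k)) (unit_exp k).
  by rewrite (nf_qvar q_antisym); apply: leadingU.
have nf_k : nf (qvar q k)
    = \sum_(u <- msupp (nf a)) (nf a)@_u *: nf (phi (monomial q u)).
  by rewrite -phi_a [in LHS](nf_expand q_antisym a) nf_phi_linext.
have [u _ lead_u] : exists2 u, u \in msupp (nf a) &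
    leading lt (nf (qvar q k)) (image_exp u).
  rewrite nf_k; apply: leading_sum => //.
    move=> u ua; apply: leadingZ; first by rewrite mcoeff_neq0.
    exact: leading_phi_monomial.
  apply: contraTneq (proj1 lead_k) => a0.
  by rewrite nf_k a0 big_nil mcoeff0 eqxx.
exact: image_exp_eq_unit (leading_uniq lt_order lead_k lead_u).
Qed.
End LeadingImages.

Section Automorphism.
Variables (F : fieldType) (n : nat) (q : 'M[F]_n) (r : nat).
Hypothesis q_antisym : mult_antisymmetric q.
Hypothesis rank_Lambda : torsion_free_rank (entry_group q) r.
Hypothesis r_ge : ('C(n.-1, 2) + 1 <= r)%N.
Variable phi : {lrmorphism qaffine_space q -> qaffine_space q}.
Variable lt : rel (exponent n).
Hypothesis lt_order : translation_order lt.

(** The image of [u] commutes with [m j] as [u] does with [X_j].  Hence exponents with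
    the same image differ by an exponent that is central in the quantum torus. *)
Lemma image_exp_inj m : (forall i, leading lt (nf (phi (qvar q i))) (m i)) ->
  injective (image_exp m).
Proof.
move=> leading_m u v uv; apply/ffunP => i.
have q0 k l : q k l != 0 by case: q_antisym.
apply/eqP; rewrite -eqz_nat -subr_eq0; apply/eqP.
move: i; apply: (commuting_exponent0 q_antisym rank_Lambda r_ge) => j.
have comm_uv : \prod_i q i j ^ (u i)%:Z = \prod_i q i j ^ (v i)%:Z.
  by rewrite -!(commutation_image_exp q_antisym lt_order leading_m) uv.
rewrite (eq_bigr (fun i => q i j ^ (u i)%:Z / q i j ^ (v i)%:Z)) => [|l _].
  rewrite prodf_div comm_uv mulfV //; apply/prodf_neq0 => l _.
  by rewrite expf_neq0.
by rewrite expfzDr // invr_expz.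
Qed.

(** The variable whose image has leading exponent [unit_exp k] is some [s k], and
    [s] preserves the entries of [q], so it is the identity. *)
Lemma leading_phi_qvar : bijective phi ->
  forall k, leading lt (nf (phi (qvar q k))) (unit_exp k).
Proof.
move=> phi_bij.
have /fin_all_exists [m leading_m] i : exists u, leading lt (nf (phi (qvar q i))) u.
  apply: leading_ex => //.
  by rewrite (nf_eq0 q_antisym) -(rmorph0 phi) (inj_eq (bij_inj phi_bij)) qvar_neq0.
have phi_surj b : exists a, phi a = b.
  by have [psi _ phiK] := phi_bij; exists (psi b).
have [s ms] := fin_all_exists
  (unit_exp_is_leading q_antisym lt_order leading_m (image_exp_inj leading_m) phi_surj).
have s_id : s =1 id.
  apply: (q_preserving_id q_antisym rank_Lambda r_ge) => i j.
  by rewrite -(commutation_m q_antisym lt_order leading_m) !ms commutation_unit.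
by move=> k; rewrite -ms s_id.
Qed.
End Automorphism.

(** * The lexicographic order and its reverse *)

Section Lexicographic.
Variable n : nat.
Implicit Types u v w : exponent n.

Definition lex u v : bool :=
  [exists i : 'I_n, (u i < v i)%N && [forall j : 'I_n, (j < i)%N ==> (u j == v j)]].

Lemma lexP u v :
  reflect (exists2 i : 'I_n, (u i < v i)%N & forall j : 'I_n, (j < i)%N -> u j = v j)
    (lex u v).
Proof.
apply: (iffP existsP) => [[i /andP[ui /forallP uj]]|[i ui uj]]; exists i => //.
  by move=> j ji; apply/eqP; apply: implyP (uj j) ji.
by rewrite ui; apply/forallP => j; apply/implyP => /uj ->.
Qed.

Lemma lex_order : translation_order lex.
Proof.
split=> [u|v u w|u v|w u v].
- by apply/negbTE/lexP => -[i]; rewrite ltnn.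
- move=> /lexP[i ui uj] /lexP[k vk vj]; apply/lexP.
  have [ik|ki|/val_inj ik] := ltngtP i k.
  + exists i => [|j ji]; first by rewrite -vj.
    by rewrite uj // vj // (ltn_trans ji).
  + exists k => [|j jk]; first by rewrite uj.
    by rewrite uj ?vj // (ltn_trans jk).
  + exists k => [|j jk]; last by rewrite uj ?ik ?vj.
    by rewrite -ik in vk *; apply: ltn_trans vk.
- move=> uv; have [i0 i0P] : exists i, u i != v i.
    apply/existsP; apply: contraNT uv => /existsPn uv.
    by apply/eqP/ffunP => i; apply/eqP; rewrite -[_ == _]negbK.
  have [i iP imin] := @arg_minnP _ i0 (fun i => u i != v i) val i0P.
  have below (j : 'I_n) : (j < i)%N -> u j = v j.
    by move=> ji; apply/eqP; apply: contraLR ji => /imin; rewrite -leqNgt.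
  apply/orP; case: (ltngtP (u i) (v i)) iP => // ui _; [left|right].
    by apply/lexP; exists i.
  by apply/lexP; exists i => // j /below.
- move=> /lexP[i ui uj]; apply/lexP; exists i => [|j /uj uvj]; rewrite !ffunE.
    by rewrite ltn_add2r.
  by rewrite uvj.
Qed.

Lemma translation_order_rev (lt : rel (exponent n)) :
  translation_order lt -> translation_order (fun u v => lt v u).
Proof.
case=> irr tr tot add; split=> [//|v u w vu wv|u v uv|w u v /add//].
  exact: tr wv vu.
by rewrite orbC; apply: tot.
Qed.
End Lexicographic.

Lemma leading_both (F : fieldType) n (lt : rel (exponent n))
    (f : {malg F[exponent n]}) u :
  translation_order lt -> leading lt f u -> leading (fun v w => lt w v) f u ->
  f = f@_u *: basis F u.
Proof.
case=> irr tr _ _ [fu Hu] [_ Hu']; apply/malgP => v; rewrite mcoeffZ mcoeff_basis.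
have [->|vu] := eqVneq u v; first by rewrite mulr1.
rewrite mulr0; apply/eqP; apply: contraT => fv; rewrite eq_sym in vu.
by have := tr _ _ _ (Hu _ vu fv) (Hu' _ vu fv); rewrite irr.
Qed.

Theorem theoremB (F : fieldType) (n : nat) (q : 'M[F]_n) (r : nat)
    (q_antisym : mult_antisymmetric q)
    (rank_Lambda : torsion_free_rank (entry_group q) r)
    (r_ge : ('C(n.-1, 2) + 1 <= r)%N) :
  (forall phi : {lrmorphism qaffine_space q -> qaffine_space q},
     bijective phi ->
     exists a : 'I_n -> F,
       (forall i, a i != 0) /\ (forall i, phi (qvar q i) = a i *: qvar q i)) /\
  (forall a : 'I_n -> F, (forall i, a i != 0) ->
     exists phi : {lrmorphism qaffine_space q -> qaffine_space q},
       bijective phi /\ (forall i, phi (qvar q i) = a i *: qvar q i)).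
Proof.
split=> [phi phi_bij|a a0]; last first.
  exists (torus (q := q) a); split; first exact: torus_bij.
  exact: torus_qvar.
exists (fun i => (nf (phi (qvar q i)))@_(unit_exp i)).
have lead lt (lt_order : translation_order lt) :=
  leading_phi_qvar q_antisym rank_Lambda r_ge lt_order phi_bij.
split=> i; first by have [] := lead _ (lex_order n) i.
apply: (nf_inj q_antisym); rewrite (nfZ q_antisym) (nf_qvar q_antisym).
apply: (leading_both (lex_order n) (lead _ (lex_order n) i)).
exact: lead _ (translation_order_rev (lex_order n)) i.
Qed.
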